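(* Let $q\in\mathbb{C}$ with $|q|<1$, $r\in\mathbb{N}$, $n\in\mathbb{Z}_{\ge0}$, let $x,a_1,\ldots,a_r\in\mathbb{C}$ have positive real parts and $b_1,\ldots,b_r\in\mathbb{Z}$, and assume these parameters are such that the multiple series below converge absolutely (e.g. $0<q<1$ and $b_1,\ldots,b_r\ge0$). Define $E^{(r)}_{n,q}(x\mid a_1,\ldots,a_r;b_1,\ldots,b_r)$ by $$[2]_q^r\sum_{m_1,\ldots,m_r=0}^{\infty}(-1)^{m_1+\cdots+m_r}q^{(b_1+1)m_1+\cdots+(b_r+1)m_r}e^{[a_1m_1+\cdots+a_rm_r+x]_q t}=\sum_{n=0}^{\infty}E^{(r)}_{n,q}(x\mid a_1,\ldots,a_r;b_1,\ldots,b_r)\frac{t^n}{n!},$$ and $$\zeta_{q,r}(s,x\mid a_1,\ldots,a_r;b_1,\ldots,b_r)=[2]_q^r\sum_{m_1,\ldots,m_r=0}^{\infty}\frac{(-q)^{m_1+\cdots+m_r}q^{b_1m_1+\cdots+b_rm_r}}{[a_1m_1+\cdots+a_rm_r+x]_q^s},\qquad s\in\mathbb{C}.$$ Then $\zeta_{q,r}(-n,x\mid a_1,\ldots,a_r;b_1,\ldots,b_r)=E^{(r)}_{n,q}(x\mid a_1,\ldots,a_r;b_1,\ldots,b_r)$.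
   Context: For $y\in\mathbb{C}$, $[y]_q=\frac{1-q^y}{1-q}$, where $q^y=e^{y\log q}$ for a fixed choice of $\log q$; $[2]_q=1+q$. *)

(* Defs.v *)
From HB Require Import structures.
From mathcomp Require Import all_boot all_order all_algebra.
From mathcomp Require Import complex.
From mathcomp Require Import all_classical all_reals all_analysis.

Set Implicit Arguments.
Unset Strict Implicit.
Unset Printing Implicit Defensive.

Import Order.TTheory GRing.Theory Num.Theory.
Import numFieldNormedType.Exports.

Local Open Scope classical_set_scope.
Local Open Scope ring_scope.
Local Open Scope complex_scope.

(* Typing R[i] as a numClosedFieldType is what gives it its normed topology. *)
Definition Cplx (R : realType) : numClosedFieldType := R[i].

Section ComplexFunctions.
Context {R : realType}.
Notation C := (Cplx R).
Implicit Types z s : C.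

Definition cre z : R := complex.Re (z : R[i]).
Definition cim z : R := complex.Im (z : R[i]).
Definition cabs z : R := cre `|z|.

Definition cexp z : C :=
  (expR (cre z) * cos (cim z)) +i* (expR (cre z) * sin (cim z)).

(* Principal argument, in ]-pi, pi], for z != 0. *)
Definition carg z : R :=
  if 0 <= cim z then acos (cre z / cabs z) else - acos (cre z / cabs z).

Definition clog z : C := ln (cabs z) +i* carg z.

(* Principal power. For s an integer and z != 0 the branch is irrelevant. At
   z = 0, together with 0^-1 = 0, it gives (cpow 0 (- n%:R))^-1 = 0 ^+ n. *)
Definition cpow z s : C :=
  if z == 0 then (s == 0)%:R else cexp (s * clog z).

End ComplexFunctions.

Section ComplexFamilies.
Context {R : realType} {I : choiceType}.
Notation C := (Cplx R).
Implicit Type f : I -> C.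

Definition csummable f : Prop :=
  summable [set: I] (fun i => (cabs (f i))%:E).

Definition rsum (g : I -> R) : R :=
  fine (\esum_(i in [set: I]) ((EFin \o g)^\+ i))%E
  - fine (\esum_(i in [set: I]) ((EFin \o g)^\- i))%E.

(* The sum of f whenever csummable f. *)
Definition csum f : C := rsum (cre \o f) +i* rsum (cim \o f).

End ComplexFamilies.

Section MultipleQEuler.
Context {R : realType}.
Notation C := (Cplx R).

(* Throughout, lq is the chosen logarithm of q: cexp lq = q. *)
Definition qpow (lq y : C) : C := cexp (y * lq).

Definition qnum (q lq y : C) : C := (1 - qpow lq y) / (1 - q).

Section Params.
Variables (q lq : C) (r : nat) (x : C) (a : 'I_r -> C) (b : 'I_r -> int).

Notation mindex := {ffun 'I_r -> nat}.

Definition qEuler_arg (m : mindex) : C :=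
  qnum q lq (\sum_(i < r) a i * (m i)%:R + x).

Definition qEuler_gf_term (t : C) (m : mindex) : C :=
  (-1) ^+ (\sum_(i < r) m i)%N
  * q ^ (\sum_(i < r) (b i + 1) * (m i)%:Z)
  * cexp (qEuler_arg m * t).

Definition qEuler_gf (t : C) : C :=
  qnum q lq 2%:R ^+ r * csum (qEuler_gf_term t).

Definition is_qEuler (E : nat -> C) : Prop :=
  \forall t \near (0 : C),
    series (fun k : nat => E k * (t ^+ k / k`!%:R)) @ \oo --> qEuler_gf t.

(* is_qEuler holds of at most one sequence; the default value is only used when
   the generating function has no expansion. *)
Definition qEuler : nat -> C := xget (fun=> 0) [set E | is_qEuler E].

Definition qzeta_term (s : C) (m : mindex) : C :=
  (- q) ^+ (\sum_(i < r) m i)%N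
  * q ^ (\sum_(i < r) b i * (m i)%:Z)
  / cpow (qEuler_arg m) s.

Definition qzeta (s : C) : C :=
  qnum q lq 2%:R ^+ r * csum (qzeta_term s).

End Params.
End MultipleQEuler.

(* Main.v *)
(* Write a term of the generating function as w_m e^(A_m t), with A_m the q-number
   in the exponent; since q = exp(lq) is nonzero, the term of the zeta series at
   -n is w_m A_m^n. Summability at the four points t = s, -s, is, -is gives
   sum_m |w_m| e^(tau |A_m|) < +oo for tau = s/2. As |e^z - sum_(k<N) z^k/k!| is at
   most 2^(1-N) e^(5|z|), for |t| <= tau/5 the Taylor polynomials in t can be summed
   over m with an error O(2^-N), so that the generating function is
   sum_n zeta(-n) t^n/n! near 0. The power series expansion being unique, these
   coefficients are the Euler numbers. *)
Require Import Defs.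
From mathcomp Require Import all_boot all_order all_algebra.
From mathcomp Require Import complex.
From mathcomp Require Import all_classical all_reals all_analysis.
From mathcomp Require Import ring lra.
Import Order.TTheory GRing.Theory Num.Theory.
Import numFieldNormedType.Exports.
Local Open Scope classical_set_scope.
Local Open Scope ring_scope.

(** * Complex numbers: real and imaginary parts, modulus, exponential, powers *)

Section ComplexBasics.
Context {R : realType}.
Notation C := (Cplx R).
Implicit Types (x y : R) (z w : C).

Definition rtoc x : C := Complex x 0.

Lemma complex_ext z w : cre z = cre w -> cim z = cim w -> z = w.
Proof. by case: z w => [a b] [c d] /= -> ->. Qed.

Lemma cre0 : cre (0 : C) = 0. Proof. by []. Qed.
Lemma cim0 : cim (0 : C) = 0. Proof. by []. Qed.
Lemma creD z w : cre (z + w) = cre z + cre w.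
Proof. by case: z w => [a b] [c d]. Qed.
Lemma cimD z w : cim (z + w) = cim z + cim w.
Proof. by case: z w => [a b] [c d]. Qed.
Lemma creN z : cre (- z) = - cre z. Proof. by case: z. Qed.
Lemma creM z w : cre (z * w) = cre z * cre w - cim z * cim w.
Proof. by case: z w => [a b] [c d]. Qed.
Lemma cimM z w : cim (z * w) = cre z * cim w + cim z * cre w.
Proof. by case: z w => [a b] [c d]. Qed.

Lemma rtocD x y : rtoc (x + y) = rtoc x + rtoc y.
Proof. by apply: complex_ext; rewrite ?creD ?cimD//= addr0. Qed.

Lemma rtocM x y : rtoc (x * y) = rtoc x * rtoc y.
Proof. by apply: complex_ext; rewrite ?creM ?cimM//= ?mul0r ?mulr0 ?subr0 ?addr0. Qed.

Lemma rtocX x n : rtoc (x ^+ n) = rtoc x ^+ n.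
Proof. by elim: n => [//|n IH]; rewrite !exprS rtocM IH. Qed.

Lemma rtoc_nat n : rtoc n%:R = n%:R.
Proof. by elim: n => [//|n IH]; rewrite -!natr1 rtocD IH. Qed.

Lemma rtocV x : rtoc x^-1 = (rtoc x)^-1.
Proof.
have [->|x0] := eqVneq x 0; first by rewrite !invr0.
have cx0 : rtoc x != 0 by apply: contra x0 => /eqP -[->].
by apply: (mulIf cx0); rewrite mulVf// -rtocM mulVf.
Qed.

Lemma cabsE z : cabs z = Num.sqrt (cre z ^+ 2 + cim z ^+ 2).
Proof. by rewrite /cabs [`|z|]normc_def. Qed.

Lemma normCE z : `|z| = rtoc (cabs z).
Proof. by rewrite cabsE [LHS]normc_def. Qed.

Lemma cabs_ge0 z : 0 <= cabs z.
Proof. by rewrite cabsE sqrtr_ge0. Qed.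

Lemma cabs0 : cabs (0 : C) = 0.
Proof. by rewrite /cabs normr0. Qed.

Lemma cabs1 : cabs (1 : C) = 1.
Proof. by rewrite /cabs normr1. Qed.

Lemma cabs_eq0 z : (cabs z == 0) = (z == 0).
Proof.
rewrite -(normr_eq0 z) normCE; apply/eqP/eqP => [->//|].
by case.
Qed.

Lemma cabsM z w : cabs (z * w) = cabs z * cabs w.
Proof. by rewrite /cabs normrM !normCE -rtocM. Qed.

Lemma cabsN z : cabs (- z) = cabs z.
Proof. by rewrite /cabs normrN. Qed.

Lemma cabsX z n : cabs (z ^+ n) = cabs z ^+ n.
Proof. by elim: n => [|n IH]; rewrite ?cabs1// !exprS cabsM IH. Qed.

Lemma cabs_rtoc x : cabs (rtoc x) = `|x|.
Proof. by rewrite cabsE /= expr0n addr0 sqrtr_sqr. Qed.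

Lemma cabsD z w : cabs (z + w) <= cabs z + cabs w.
Proof.
have := ler_normD z w; rewrite !normCE -rtocD lecE /=.
by case/andP.
Qed.

Lemma cre_le_cabs z : `|cre z| <= cabs z.
Proof. by rewrite cabsE -sqrtr_sqr ler_wsqrtr// lerDl sqr_ge0. Qed.

Lemma cim_le_cabs z : `|cim z| <= cabs z.
Proof. by rewrite cabsE -sqrtr_sqr ler_wsqrtr// lerDr sqr_ge0. Qed.

Lemma cabs_le_parts z : cabs z <= `|cre z| + `|cim z|.
Proof.
rewrite cabsE -[leRHS]ger0_norm ?addr_ge0// -sqrtr_sqr ler_wsqrtr//.
rewrite sqrrD !real_normK ?num_real// lerD2r lerDl mulrn_wge0// mulr_ge0//.
Qed.

(** The norm on [C] takes values in [C], whose order compares only numbers with equal imaginary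
    parts. A positive radius is thus a positive real, and convergence can be tested with the
    real-valued [cabs]. *)
Lemma cvg_cabsP (u : nat -> C) (l : C) :
  u @ \oo --> l <-> (forall e, 0 < e -> \forall n \near \oo, cabs (l - u n) < e).
Proof.
split=> [/cvgrPdist_lt ul e e0|ul].
  have e0' : 0 < rtoc e by rewrite ltcE /= eqxx.
  apply: filterS (ul _ e0') => n.
  by rewrite normCE ltcE /= eqxx.
apply/cvgrPdist_lt => e; rewrite ltcE => /andP[/eqP ime ree].
apply: filterS (ul _ ree) => n ltn.
by rewrite normCE ltcE /= ltn andbT; apply/eqP.
Qed.

Lemma near0_cabsP (P : C -> Prop) :
  (\forall t \near (0 : C), P t) <->
  (exists2 e, 0 < e & forall t, cabs t < e -> P t).
Proof.
split=> [/nbhs_ballP[e /= e0 Pe]|[e e0 Pe]].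
  move: e0; rewrite ltcE => /andP[/eqP ime ree].
  exists (cre e) => // t te; apply: Pe.
  by rewrite -ball_normE /= sub0r normrN normCE ltcE /= te andbT; apply/eqP.
apply/nbhs_ballP; exists (rtoc e) => /=; first by rewrite ltcE /= eqxx.
move=> t; rewrite -ball_normE /= sub0r normrN normCE ltcE /= eqxx => te.
exact: Pe.
Qed.

Lemma cre_cexp z : cre (cexp z) = expR (cre z) * cos (cim z).
Proof. by []. Qed.

Lemma cim_cexp z : cim (cexp z) = expR (cre z) * sin (cim z).
Proof. by []. Qed.

Lemma cexp0 : cexp (0 : C) = 1.
Proof.
by apply: complex_ext; rewrite ?cre_cexp ?cim_cexp cre0 cim0 expR0 ?cos0 ?sin0 mul1r.
Qed.

Lemma cexpD z w : cexp (z + w) = cexp z * cexp w.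
Proof.
apply: complex_ext.
  by rewrite creM !cre_cexp !cim_cexp creD cimD expRD cosD; ring.
by rewrite cimM !cre_cexp !cim_cexp creD cimD expRD sinD; ring.
Qed.

Lemma cabs_cexp z : cabs (cexp z) = expR (cre z).
Proof.
rewrite cabsE cre_cexp cim_cexp !exprMn -mulrDr cos2Dsin2 mulr1 sqrtr_sqr.
by rewrite ger0_norm ?expR_ge0.
Qed.

Lemma cexp_neq0 z : cexp z != 0.
Proof. by rewrite -cabs_eq0 cabs_cexp expR_eq0. Qed.

Lemma cexpN z : cexp (- z) = (cexp z)^-1.
Proof.
by apply: (mulfI (cexp_neq0 z)); rewrite -cexpD subrr cexp0 mulfV// cexp_neq0.
Qed.

Lemma cexpMn z n : cexp (n%:R * z) = cexp z ^+ n.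
Proof.
elim: n => [|n IH]; first by rewrite mul0r cexp0.
by rewrite -natr1 mulrDl mul1r cexpD IH exprSr.
Qed.

(** The cosine of [carg z] gives back the real part for either sign of the angle. As the sine of an
    arccosine is nonnegative, the case split in [carg] restores the sign of the imaginary part. *)
Lemma cexp_clog z : z != 0 -> cexp (clog z) = z.
Proof.
move=> z0; have r0 : 0 < cabs z by rewrite lt_def cabs_eq0 z0 cabs_ge0.
have cN1 : -1 <= cre z / cabs z <= 1.
  by rewrite -ler_norml normrM normfV (ger0_norm (cabs_ge0 z)) ler_pdivrMr// mul1r
             cre_le_cabs.
have sE : cabs z * Num.sqrt (1 - (cre z / cabs z) ^+ 2) = `|cim z|.
  have c2 : cabs z ^+ 2 = cre z ^+ 2 + cim z ^+ 2.
    by rewrite cabsE sqr_sqrtr// addr_ge0 ?sqr_ge0.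
  have -> : 1 - (cre z / cabs z) ^+ 2 = (cim z / cabs z) ^+ 2.
    by rewrite !exprMn exprVn c2; field; rewrite -c2 expf_neq0// gt_eqF.
  by rewrite sqrtr_sqr normrM normfV (gtr0_norm r0) mulrCA divff ?mulr1// gt_eqF.
apply: complex_ext; rewrite ?cre_cexp ?cim_cexp /= lnK ?posrE// /carg.
  have cE : cabs z * cos (acos (cre z / cabs z)) = cre z.
    by rewrite acosK ?in_itv//= mulrCA divff ?mulr1// gt_eqF.
  by case: ifP; rewrite ?cosN cE.
case: ifPn => [i0|]; rewrite ?sinN ?mulrN sin_acos// sE.
  by rewrite ger0_norm.
by rewrite -ltNge => i0; rewrite ltr0_norm// opprK.
Qed.

(** For [z != 0] this is the exponential of an integer multiple of a logarithm. At [z = 0] the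
    default values of [cpow] and of the inverse yield 1 for [n = 0] and 0 otherwise, as [0 ^+ n]
    does. *)
Lemma cpow_opp_nat z n : (cpow z (- n%:R))^-1 = z ^+ n.
Proof.
rewrite /cpow; case: eqVneq => [->|z0].
  by rewrite oppr_eq0 pnatr_eq0 expr0n; case: (n == 0)%N; rewrite ?invr1 ?invr0.
by rewrite mulNr cexpN cexpMn cexp_clog// invrK.
Qed.

End ComplexBasics.

(** * Absolutely summable families over an arbitrary index type *)

Section Families.
Context {R : realType} {I : choiceType}.
Notation C := (Cplx R).
Implicit Types (u v g h : I -> R) (f : I -> C).

Definition rsummable u := summable [set: I] (EFin \o u).

Definition psum u : R := fine (\esum_(i in [set: I]) (u i)%:E)%E.

Lemma le_rsummable g u : rsummable u -> (forall i, `|g i| <= u i) -> rsummable g.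
Proof.
move=> su gu; apply: le_lt_trans su; apply: le_esum => i _ /=.
by rewrite lee_fin (le_trans (gu i)) ?ler_norm.
Qed.

Lemma rsummableD u v : rsummable u -> rsummable v -> rsummable (fun i => u i + v i).
Proof. exact: summableD. Qed.

Lemma rsummable_abs u : rsummable u -> rsummable (fun i => `|u i|).
Proof.
apply: le_lt_trans; apply: le_esum => i _ /=.
by rewrite normr_id.
Qed.

Lemma esum_fin_num u : (forall i, 0 <= u i) -> rsummable u ->
  (\esum_(i in [set: I]) (u i)%:E)%E \is a fin_num.
Proof.
move=> u0; rewrite /rsummable summableE; congr (is_true (_ \is a fin_num)).
by apply: eq_esum => i _ /=; rewrite ger0_norm.
Qed.

Lemma psum_ge0 u : (forall i, 0 <= u i) -> 0 <= psum u.
Proof. by move=> u0; apply/fine_ge0/esum_ge0 => i _; rewrite lee_fin. Qed.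

Lemma psumD u v : (forall i, 0 <= u i) -> (forall i, 0 <= v i) ->
  rsummable u -> rsummable v -> psum (fun i => u i + v i) = psum u + psum v.
Proof.
move=> u0 v0 su sv; rewrite -fineD ?esum_fin_num//; congr fine.
by rewrite -esumD// => i _; rewrite lee_fin.
Qed.

Lemma psum_le u v : (forall i, 0 <= u i) -> (forall i, u i <= v i) ->
  rsummable v -> psum u <= psum v.
Proof.
move=> u0 uv sv; have v0 i : 0 <= v i by exact: le_trans (uv i).
apply: fine_le; rewrite ?esum_fin_num//.
  by apply: le_rsummable sv _ => i; rewrite ger0_norm.
by apply: le_esum => i _; rewrite lee_fin.
Qed.

Lemma esumZl_le (c : R) u : 0 <= c -> (forall i, 0 <= u i) ->
  (\esum_(i in [set: I]) (c * u i)%:E <= c%:E * \esum_(i in [set: I]) (u i)%:E)%E.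
Proof.
move=> c0 u0; apply: ge_ereal_sup => _ [A [finA _] <-].
rewrite (eq_fsbigr (fun i => c%:E * (u i)%:E)%E); last by move=> i _; rewrite EFinM.
rewrite -ge0_mule_fsumr; last by move=> i; rewrite lee_fin.
rewrite lee_wpmul2l ?lee_fin//; apply: ereal_sup_ubound => /=.
by exists A.
Qed.

Lemma rsummableZ (c : R) u : rsummable u -> rsummable (fun i => c * u i).
Proof.
move=> su; apply: (@le_rsummable _ (fun i => `|c| * `|u i|)); last first.
  by move=> i; rewrite normrM.
rewrite /rsummable/summable.
rewrite (eq_esum (b := fun i => (`|c| * `|u i|)%:E)); last first.
  by move=> i _; rewrite gee0_abs// lee_fin mulr_ge0.
apply: (le_lt_trans (@esumZl_le _ _ _ _)) => //.
by rewrite lte_mul_pinfty// ?lee_fin//.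
Qed.

Lemma psumZ (c : R) u : 0 <= c -> (forall i, 0 <= u i) -> rsummable u ->
  psum (fun i => c * u i) = c * psum u.
Proof.
move=> c0 u0 su.
have cu0 i : 0 <= c * u i by rewrite mulr_ge0.
have le (d : R) v : 0 <= d -> (forall i, 0 <= v i) -> rsummable v ->
    psum (fun i => d * v i) <= d * psum v.
  move=> d0 v0 sv; rewrite -lee_fin EFinM !fineK ?esum_fin_num//.
  - exact: esumZl_le.
  - by move=> i; rewrite mulr_ge0.
  - exact: rsummableZ.
apply/eqP; rewrite eq_le le//=.
have [->|cN0] := eqVneq c 0.
  by rewrite mul0r psum_ge0// => i; rewrite mul0r.
have cp : 0 < c by rewrite lt_def cN0.
(* The reverse inequality is the one already proved, applied to the factor [c^-1] and the family
   [c * u i]. *)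
rewrite mulrC -ler_pdivlMr// mulrC.
have -> : psum u = psum (fun i => c^-1 * (c * u i)).
  by congr psum; apply/funext => i; rewrite mulKf.
by apply: le => //; [rewrite invr_ge0|exact: rsummableZ].
Qed.

(** [rsum] is defined through positive and negative parts, which do not add up under addition of
    families. Here any splitting into two nonnegative summable families is allowed, and linearity of
    [rsum] follows from that of [psum]. *)
Lemma rsum_diff u v : (forall i, 0 <= u i) -> (forall i, 0 <= v i) ->
  rsummable u -> rsummable v -> rsum (fun i => u i - v i) = psum u - psum v.
Proof.
move=> u0 v0 su sv.
have sd : rsummable (fun i => u i - v i)
  by exact: (@summableB _ _ _ (EFin \o u) (EFin \o v)).
rewrite /psum -fineB ?esum_fin_num//.
rewrite -(@esumB _ _ [set: I] (EFin \o u) (EFin \o v) su sv (fun i _ => u0 i)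
  (fun i _ => v0 i)).
rewrite /rsum fineB//.
  have := summable_funepos sd; rewrite summableE.
  by under eq_esum do rewrite gee0_abs//.
have := summable_funeneg sd; rewrite summableE.
by under eq_esum do rewrite gee0_abs//.
Qed.

Lemma rpos_ge0 (x : R) : 0 <= Num.max x 0.
Proof. by rewrite le_max lexx orbT. Qed.

Lemma rposneg g i : g i = Num.max (g i) 0 - Num.max (- g i) 0.
Proof. by case: (leP (g i) 0); case: (leP (- g i) 0); lra. Qed.

Lemma rsummable_pos g : rsummable g -> rsummable (fun i => Num.max (g i) 0).
Proof.
move/rsummable_abs => sg; apply: le_rsummable sg _ => i.
by rewrite ger0_norm ?le_max ?lexx ?orbT// ge_max ler_norm normr_ge0.
Qed.

Lemma rsumE g : rsummable g ->
  rsum g = psum (fun i => Num.max (g i) 0) - psum (fun i => Num.max (- g i) 0).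
Proof.
move=> sg; rewrite -rsum_diff.
- by congr rsum; apply/funext => i; exact: rposneg.
- by move=> i; exact: rpos_ge0.
- by move=> i; exact: rpos_ge0.
- exact: rsummable_pos.
- by apply: rsummable_pos; move: sg; rewrite /rsummable summableN.
Qed.

Lemma rsummableN g : rsummable g -> rsummable (fun i => - g i).
Proof. by rewrite /rsummable summableN. Qed.

Lemma rsumD g h : rsummable g -> rsummable h ->
  rsum (fun i => g i + h i) = rsum g + rsum h.
Proof.
move=> sg sh; rewrite (rsumE _ sg) (rsumE _ sh).
have sp := rsummable_pos.
have [sNg sNh] := (rsummableN _ sg, rsummableN _ sh).
rewrite addrACA -opprD -!psumD ?sp//; [|by move=> i; apply: rpos_ge0..].
rewrite -rsum_diff.
- by congr rsum; apply/funext => i; have := rposneg g i; have := rposneg h i; lra.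
- by move=> i; rewrite addr_ge0 ?rpos_ge0.
- by move=> i; rewrite addr_ge0 ?rpos_ge0.
- by apply: rsummableD; exact: sp.
- by apply: rsummableD; exact: sp.
Qed.

Lemma rsumN g : rsummable g -> rsum (fun i => - g i) = - rsum g.
Proof.
move=> sg; rewrite !rsumE//; last exact: rsummableN.
by rewrite opprB; congr (_ - psum _); apply/funext => i; rewrite opprK.
Qed.

Lemma rsumZ (c : R) g : rsummable g -> rsum (fun i => c * g i) = c * rsum g.
Proof.
wlog c0 : c / 0 <= c => [hw|] sg.
  have [/hw|c0] := leP 0 c; first exact.
  rewrite -[c]opprK mulNr -hw ?oppr_ge0 1?ltW//.
  rewrite -rsumN; last exact: rsummableZ.
  by congr rsum; apply/funext => i; rewrite mulNr.
have sp := rsummable_pos _ sg.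
have sn := rsummable_pos _ (rsummableN _ sg).
have p0 i : 0 <= Num.max (g i) 0 by exact: rpos_ge0.
have n0 i : 0 <= Num.max (- g i) 0 by exact: rpos_ge0.
rewrite (rsumE _ sg) mulrBr -!psumZ// -rsum_diff.
- by congr rsum; apply/funext => i; rewrite -mulrBr -rposneg.
- by move=> i; rewrite mulr_ge0.
- by move=> i; rewrite mulr_ge0.
- exact: rsummableZ.
- exact: rsummableZ.
Qed.

(** [rsum g] is a difference of two numbers that both lie between 0 and [psum u]. *)
Lemma rsum_le_psum g u : rsummable u -> (forall i, `|g i| <= u i) ->
  `|rsum g| <= psum u.
Proof.
move=> su gu; have sg := le_rsummable _ _ su gu.
have u0 i : 0 <= u i by exact: le_trans (gu i).
have le k : (forall i, `|k i| <= u i) -> psum (fun i => Num.max (k i) 0) <= psum u.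
  move=> ku; apply: psum_le => // i; first exact: rpos_ge0.
  by rewrite ge_max u0 (le_trans (ler_norm _)).
rewrite rsumE// ler_norml.
have := le g gu; have := psum_ge0 _ (fun i => rpos_ge0 (g i)).
have := psum_ge0 _ (fun i => rpos_ge0 (- g i)).
have : psum (fun i => Num.max (- g i) 0) <= psum u.
  by apply: le => i; rewrite normrN.
by lra.
Qed.

Lemma le_csummable f u : rsummable u -> (forall i, cabs (f i) <= u i) -> csummable f.
Proof.
move=> su fu; apply: le_rsummable su _ => i.
by rewrite ger0_norm ?cabs_ge0.
Qed.

Lemma csummable_cre f : csummable f -> rsummable (cre \o f).
Proof. by move=> sf; apply: le_rsummable sf _ => i; exact: cre_le_cabs. Qed.

Lemma csummable_cim f : csummable f -> rsummable (cim \o f).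
Proof. by move=> sf; apply: le_rsummable sf _ => i; exact: cim_le_cabs. Qed.

Lemma csummableD f1 f2 : csummable f1 -> csummable f2 ->
  csummable (fun i => f1 i + f2 i).
Proof.
move=> s1 s2; apply: le_csummable (rsummableD _ _ s1 s2) _ => i.
exact: cabsD.
Qed.

Lemma csummableZ (c : C) f : csummable f -> csummable (fun i => c * f i).
Proof.
move=> sf; apply: le_csummable (rsummableZ (cabs c) _ sf) _ => i.
by rewrite cabsM.
Qed.

Lemma csumD f1 f2 : csummable f1 -> csummable f2 ->
  csum (fun i => f1 i + f2 i) = csum f1 + csum f2.
Proof.
move=> s1 s2; apply: complex_ext; rewrite ?creD ?cimD /=.
  rewrite -rsumD; [|exact: csummable_cre..].
  by congr rsum; apply/funext => i /=; rewrite creD.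
rewrite -rsumD; [|exact: csummable_cim..].
by congr rsum; apply/funext => i /=; rewrite cimD.
Qed.

Lemma csumZ (c : C) f : csummable f -> csum (fun i => c * f i) = c * csum f.
Proof.
move=> sf; have [sr si] := (csummable_cre _ sf, csummable_cim _ sf).
apply: complex_ext; rewrite ?creM ?cimM /=.
  rewrite -mulNr -!rsumZ// -rsumD; [|exact: rsummableZ..].
  by congr rsum; apply/funext => i /=; rewrite creM mulNr.
rewrite -!rsumZ// -rsumD; [|exact: rsummableZ..].
by congr rsum; apply/funext => i /=; rewrite cimM.
Qed.

Lemma csum0 : csum (fun _ : I => 0 : C) = 0.
Proof.
have s0 : csummable (fun _ : I => 0 : C).
  by rewrite /csummable/summable esum1// => i _ /=; rewrite cabs0 normr0.
by have := csumZ 0 _ s0; rewrite !mul0r.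
Qed.

(** Summability and value are proved together, since additivity at each induction step needs the
    partial sum to be summable. *)
Lemma csum_bigsum (F : nat -> I -> C) n : (forall k, csummable (F k)) ->
  csummable (fun i => \sum_(0 <= k < n) F k i) /\
  csum (fun i => \sum_(0 <= k < n) F k i) = \sum_(0 <= k < n) csum (F k).
Proof.
move=> sF; elim: n => [|n [sn IH]].
  rewrite big_nil; have -> : (fun i => \sum_(0 <= k < 0) F k i) = fun=> 0.
    by apply/funext => i; rewrite big_nil.
  split; last exact: csum0.
  by rewrite /csummable/summable esum1// => i _ /=; rewrite cabs0 normr0.
have -> : (fun i => \sum_(0 <= k < n.+1) F k i) =
          (fun i => \sum_(0 <= k < n) F k i + F n i).
  by apply/funext => i; rewrite big_nat_recr.
by rewrite csumD// IH big_nat_recr//=; split=> //; exact: csummableD.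
Qed.

(** The factor 2 comes from bounding real and imaginary parts separately. *)
Lemma cabs_csum_le f u : rsummable u -> (forall i, cabs (f i) <= u i) ->
  cabs (csum f) <= 2 * psum u.
Proof.
move=> su fu; apply: (le_trans (cabs_le_parts _)) => /=.
have h1 : `|rsum (cre \o f)| <= psum u.
  by apply: rsum_le_psum su _ => i; rewrite (le_trans (cre_le_cabs _)).
have h2 : `|rsum (cim \o f)| <= psum u.
  by apply: rsum_le_psum su _ => i; rewrite (le_trans (cim_le_cabs _)).
lra.
Qed.

End Families.

(** * Explicit Taylor remainder of the complex exponential *)

Section Taylor.
Context {R : realType}.
Notation C := (Cplx R).

Let scaleRE (a b : R) : a *: b = a * b.
Proof. by []. Qed.

Lemma pow_fact_is_derive (n : nat) (s : R) :
  is_derive s 1 (fun s => s ^+ n.+1 / n.+1`!%:R) (s ^+ n / n`!%:R).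
Proof.
have h : is_derive s 1 (fun s : R => s ^+ n.+1) (n.+1%:R * s ^+ n).
  have := @is_deriveX R R id n.+1 s 1 1 (is_derive_id _ _).
  by rewrite exprfctE scaleRE mulr1.
have := @is_deriveM R R _ (cst (n.+1`!%:R^-1)) s 1 _ 0 h (is_derive_cst _ _ _).
move=> /is_derive_eq; apply.
rewrite /cst !scaleRE mulr0 add0r factS natrM.
by rewrite invfM mulrACA mulVf ?pnatr_eq0// mul1r mulrC.
Qed.

(** The difference of the two sides vanishes at 0 and has a nonnegative derivative on the unit
    interval, so the mean value theorem applies. *)
Lemma antiderivative_le (f df : R -> R) (K : R) (n : nat) :
  f 0 = 0 -> (forall s : R, is_derive s 1 f (df s)) ->
  (forall s : R, 0 <= s <= 1 -> df s <= K * (s ^+ n / n`!%:R)) ->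
  forall s : R, 0 <= s <= 1 -> f s <= K * (s ^+ n.+1 / n.+1`!%:R).
Proof.
move=> f0 fd le s /andP[s0 s1].
pose g (t : R) := K * (t ^+ n.+1 / n.+1`!%:R) - f t.
have gd (t : R) : is_derive t 1 g (K * (t ^+ n / n`!%:R) - df t).
  exact: (is_deriveB (is_deriveZ K (pow_fact_is_derive n t)) (fd t)).
have gc : {within `[0, s], continuous g}.
  apply: continuous_subspaceT => t.
  by apply: differentiable_continuous; apply/derivable1_diffP; apply: ex_derive.
have [c] := MVT_segment s0 (fun t _ => gd t) gc.
rewrite in_itv /= => /andP[c0 cs].
rewrite /g f0 expr0n mul0r mulr0 !subr0 => e.
rewrite -subr_ge0 e mulr_ge0// subr_ge0 le// c0 //.
exact: le_trans s1.
Qed.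

Lemma antiderivative_norm_le (f df : R -> R) (K : R) (n : nat) :
  f 0 = 0 -> (forall s : R, is_derive s 1 f (df s)) ->
  (forall s : R, 0 <= s <= 1 -> `|df s| <= K * (s ^+ n / n`!%:R)) ->
  forall s : R, 0 <= s <= 1 -> `|f s| <= K * (s ^+ n.+1 / n.+1`!%:R).
Proof.
move=> f0 fd le s s01; rewrite ler_norml; apply/andP; split; last first.
  apply: antiderivative_le f0 fd _ _ s01 => t /le; exact/le_trans/ler_norm.
rewrite lerNl.
apply: (@antiderivative_le (fun t => - f t) (fun t => - df t)) => //.
- by rewrite f0 oppr0.
- move=> t /le; apply: le_trans.
  by rewrite -normrN ler_norm.
Qed.

Definition cexp_partial (n : nat) (z : C) : C := \sum_(0 <= k < n) z ^+ k / k`!%:R.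

(** The remainder along the segment from 0 to [z]: a function of one real variable, open to real
    calculus. *)
Definition cexp_rem (z : C) n (s : R) : C :=
  cexp (rtoc s * z) - cexp_partial n (rtoc s * z).

Lemma cre_rtocM (s : R) (z : C) : cre (rtoc s * z) = s * cre z.
Proof. by rewrite creM /= mul0r subr0. Qed.

Lemma cim_rtocM (s : R) (z : C) : cim (rtoc s * z) = s * cim z.
Proof. by rewrite cimM /= mul0r addr0. Qed.

Let mulr_is_derive (a s : R) : is_derive s 1 (fun s => s * a) a.
Proof.
have := @is_deriveM R R id (cst a) s 1 1 0 (is_derive_id _ _) (is_derive_cst _ _ _).
move=> /is_derive_eq; apply.
by rewrite !scaleRE mulr0 add0r mulr1.
Qed.

Lemma cexp_cre_is_derive (z : C) (s : R) :
  is_derive s 1 (fun s => cre (cexp (rtoc s * z))) (cre (z * cexp (rtoc s * z))).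
Proof.
rewrite (_ : (fun s => _) = (fun s => expR (s * cre z) * cos (s * cim z))); last first.
  by apply/funext => t; rewrite cre_cexp cre_rtocM cim_rtocM.
have hE := @is_derive1_comp _ expR (fun t : R => t * cre z) s _ _
  (is_derive_expR _) (mulr_is_derive (cre z) s).
have hC := @is_derive1_comp _ cos (fun t : R => t * cim z) s _ _
  (is_derive_cos _) (mulr_is_derive (cim z) s).
have := @is_deriveM R R _ _ s 1 _ _ hE hC.
move=> /is_derive_eq; apply.
rewrite creM cre_cexp cim_cexp cre_rtocM cim_rtocM /= !scaleRE.
by ring.
Qed.

Lemma cexp_cim_is_derive (z : C) (s : R) :
  is_derive s 1 (fun s => cim (cexp (rtoc s * z))) (cim (z * cexp (rtoc s * z))).
Proof.
rewrite (_ : (fun s => _) = (fun s => expR (s * cre z) * sin (s * cim z))); last first.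
  by apply/funext => t; rewrite cim_cexp cre_rtocM cim_rtocM.
have hE := @is_derive1_comp _ expR (fun t : R => t * cre z) s _ _
  (is_derive_expR _) (mulr_is_derive (cre z) s).
have hC := @is_derive1_comp _ sin (fun t : R => t * cim z) s _ _
  (is_derive_sin _) (mulr_is_derive (cim z) s).
have := @is_deriveM R R _ _ s 1 _ _ hE hC.
move=> /is_derive_eq; apply.
rewrite cimM cre_cexp cim_cexp cre_rtocM cim_rtocM /= !scaleRE.
by ring.
Qed.

Lemma cexp_partial_rtoc (z : C) n (s : R) : cexp_partial n (rtoc s * z) =
  \sum_(0 <= k < n) rtoc (s ^+ k / k`!%:R) * z ^+ k.
Proof.
apply: eq_bigr => k _.
by rewrite exprMn rtocM rtocX rtocV rtoc_nat mulrAC.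
Qed.

(** [L] stands for [cre] or [cim], so that one induction serves both parts. *)
Lemma cexp_partial_is_derive (L : C -> R) (z : C) n (s : R) :
  {morph L : x y / x + y} -> L 0 = 0 ->
  (forall (a : R) (w : C), L (rtoc a * w) = a * L w) ->
  is_derive s 1 (fun s => L (cexp_partial n.+1 (rtoc s * z)))
    (L (z * cexp_partial n (rtoc s * z))).
Proof.
move=> LD L0 LZ; elim: n => [|n IH].
  rewrite (_ : (fun s => _) = cst (L 1)).
    by rewrite /cexp_partial big_nil mulr0 L0; exact: is_derive_cst.
  by apply/funext => t; rewrite /cexp_partial big_nat1 expr0 fact0 divr1.
rewrite (_ : (fun s => _) = (fun s => L (cexp_partial n.+1 (rtoc s * z))) +
    (fun s => L (z ^+ n.+1) * (s ^+ n.+1 / n.+1`!%:R))); last first.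
  apply/funext => t /=; rewrite [RHS]/(_ + _) !cexp_partial_rtoc.
  by rewrite big_nat_recr//= LD LZ; congr (_ + _); rewrite mulrC.
have h := is_deriveZ (L (z ^+ n.+1)) (pow_fact_is_derive n s).
have := is_deriveD IH h.
move=> /is_derive_eq; apply.
rewrite !cexp_partial_rtoc big_nat_recr//= mulrDr LD; congr (_ + _).
by rewrite mulrCA -exprS LZ scaleRE mulrC.
Qed.

(** The remainder of order [n.+1] vanishes at 0 and its derivative is [z] times the remainder of
    order [n], so the bound is integrated once per order. Each part of that product is a combination
    of two real products, whence a factor 2 each time. *)
Lemma cexp_rem_le (z : C) n s : 0 <= s <= 1 ->
  `|cre (cexp_rem z n s)| <= (2 * cabs z) ^+ n * expR (cabs z) * (s ^+ n / n`!%:R) /\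
  `|cim (cexp_rem z n s)| <= (2 * cabs z) ^+ n * expR (cabs z) * (s ^+ n / n`!%:R).
Proof.
have c0 := cabs_ge0 z.
elim: n s => [|n IH] s s01.
  rewrite !expr0 fact0 divr1 mulr1 mul1r /cexp_rem /cexp_partial big_nil subr0.
  have le : cabs (cexp (rtoc s * z)) <= expR (cabs z).
    rewrite cabs_cexp ler_expR cre_rtocM.
    have /(le_trans (ler_norm _)) := cre_le_cabs z.
    move: s01 => /andP[s0 s1] h.
    rewrite (le_trans (ler_wpM2l s0 h))// ler_piMl//.
  split; apply: le_trans le; [exact: cre_le_cabs|exact: cim_le_cabs].
have r0 : cexp_rem z n.+1 0 = 0.
  rewrite /cexp_rem mul0r cexp0 /cexp_partial big_nat_recl// expr0 fact0 divr1.
  by rewrite big1 ?addr0 ?subrr// => k _; rewrite expr0n mul0r.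
have remD (L : C -> R) : {morph L : x y / x + y} -> L 0 = 0 ->
    (forall (a : R) (w : C), L (rtoc a * w) = a * L w) ->
    (forall t : R, is_derive t 1 (fun t => L (cexp (rtoc t * z)))
       (L (z * cexp (rtoc t * z)))) ->
    forall t : R, is_derive t 1 (fun t => L (cexp_rem z n.+1 t)) (L (z * cexp_rem z n t)).
  move=> LD L0 LZ de t.
  have LB x y : L (x - y) = L x - L y.
    by apply/eqP; rewrite eq_sym subr_eq -LD subrK.
  rewrite (_ : (fun t => _) = (fun t => L (cexp (rtoc t * z))) -
     (fun t => L (cexp_partial n.+1 (rtoc t * z)))); last first.
    by apply/funext => u; rewrite /cexp_rem LB.
  rewrite /cexp_rem mulrBr LB.
  exact: (is_deriveB (de t) (cexp_partial_is_derive L z n t LD L0 LZ)).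
(* Here [x] and [y] are the two parts of [z], in one order for the real part of the derivative and
   in the other for its imaginary part. *)
have le (t : R) : 0 <= t <= 1 -> forall x y, `|x| <= cabs z -> `|y| <= cabs z ->
  `|x| * `|cre (cexp_rem z n t)| + `|y| * `|cim (cexp_rem z n t)| <=
  (2 * cabs z) ^+ n.+1 * expR (cabs z) * (t ^+ n / n`!%:R).
  move=> /IH[]; set B := _ * _ => h1 h2 x y hx hy.
  rewrite [leRHS](_ : _ = 2 * (cabs z * B)); last by rewrite /B exprS; ring.
  have := ler_pM (normr_ge0 x) (normr_ge0 _) hx h1.
  have := ler_pM (normr_ge0 y) (normr_ge0 _) hy h2.
  lra.
split.
  apply: (@antiderivative_norm_le (fun t => cre (cexp_rem z n.+1 t))
            (fun t => cre (z * cexp_rem z n t)) _ n _ _ _ s s01).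
  - by rewrite r0.
  - apply: remD => //; [exact: creD|exact: cre_rtocM|exact: cexp_cre_is_derive].
  - move=> t /le /(_ _ _ (cre_le_cabs z) (cim_le_cabs z)); apply: le_trans.
    by rewrite creM (le_trans (ler_normB _ _))// !normrM.
apply: (@antiderivative_norm_le (fun t => cim (cexp_rem z n.+1 t))
            (fun t => cim (z * cexp_rem z n t)) _ n _ _ _ s s01).
- by rewrite r0.
- apply: remD => //; [exact: cimD|exact: cim_rtocM|exact: cexp_cim_is_derive].
- move=> t /le /(_ _ _ (cim_le_cabs z) (cre_le_cabs z)); apply: le_trans.
  by rewrite cimM addrC (le_trans (ler_normD _ _))// !normrM.
Qed.

Lemma cexp_taylor (z : C) n : cabs (cexp z - cexp_partial n z) <=
  2 * ((2 * cabs z) ^+ n / n`!%:R) * expR (cabs z).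
Proof.
have /(cexp_rem_le z n)[] : (0 : R) <= 1 <= (1 : R) by rewrite ler01 lexx.
rewrite /cexp_rem (_ : rtoc 1 = 1)// !mul1r expr1n mul1r => h1 h2.
by rewrite (le_trans (cabs_le_parts _))//; lra.
Qed.

Lemma pow_fact_le_expR (x : R) n : 0 <= x -> x ^+ n / n`!%:R <= expR x.
Proof.
case: n => [|n] x0.
  by rewrite fact0 divr1 expr0 (le_trans _ (expR_ge1Dx _))// lerDl.
by rewrite (le_trans _ (expR_ge1Dxn n x0))// lerDr.
Qed.

(** The factorial is traded for geometric decay: (2|z|)^n/n! = 2^(-n) (4|z|)^n/n! is at most 2^(-n)
    e^(4|z|), and the remaining e^(|z|) raises 4 to 5. *)
Lemma cexp_partial_cvg_bound (z : C) n : cabs (cexp z - cexp_partial n z) <=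
  2 * 2^-1 ^+ n * expR (5 * cabs z).
Proof.
have c0 := cabs_ge0 z.
apply: (le_trans (cexp_taylor z n)).
rewrite -!mulrA ler_wpM2l//.
have -> : 5 * cabs z = 4 * cabs z + cabs z by ring.
rewrite expRD !mulrA ler_wpM2r ?expR_ge0//.
rewrite (_ : 2 * cabs z = 2^-1 * (4 * cabs z)); last by field.
by rewrite exprMn -mulrA ler_wpM2l ?exprn_ge0// pow_fact_le_expR// mulr_ge0.
Qed.

End Taylor.

(** * Expanding a summable family of exponentials in powers of t *)

Section ExponentialFamilies.
Context {R : realType} {I : choiceType}.
Notation C := (Cplx R).
Variables w A : I -> C.
Hypothesis gf_summable : \forall t \near (0 : C),
  csummable (fun i => w i * cexp (A i * t)).

(* The four directions t = s, -s, is, -is dominate e^(s |A| / 2), although each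
   single t only controls the real part of A t. *)
Lemma exp_moment_summable : exists2 tau, 0 < tau &
  rsummable (fun i => cabs (w i) * expR (tau * cabs (A i))).
Proof.
have /near0_cabsP[e e0 sume] := gf_summable.
pose s := e / 2; have s0 : 0 < s by rewrite divr_gt0.
exists (s / 2); first by rewrite divr_gt0.
have se : s < e by rewrite /s; lra.
have s1 : cabs (rtoc s) < e by rewrite cabs_rtoc gtr0_norm.
have s2 : cabs (- rtoc s) < e by rewrite cabsN.
pose si : C := Complex 0 s.
have s3 : cabs si < e by rewrite cabsE /= expr0n add0r sqrtr_sqr gtr0_norm.
have s4 : cabs (- si) < e by rewrite cabsN.
have := rsummableD _ _ (rsummableD _ _ (sume _ s1) (sume _ s2))
                       (rsummableD _ _ (sume _ s3) (sume _ s4)).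
move=> /le_rsummable; apply => i.
rewrite ger0_norm ?mulr_ge0 ?cabs_ge0 ?expR_ge0// !cabsM !cabs_cexp -!mulrDr.
rewrite ler_wpM2l ?cabs_ge0//.
have -> : cre (A i * rtoc s) = s * cre (A i) by rewrite mulrC cre_rtocM.
have -> : cre (A i * - rtoc s) = - (s * cre (A i)).
  by rewrite mulrN creN mulrC cre_rtocM.
have -> : cre (A i * si) = - (s * cim (A i)) by rewrite creM /=; ring.
have -> : cre (A i * - si) = s * cim (A i).
  by rewrite mulrN creN creM /=; ring.
set x := cre _; set y := cim _.
have norm_le (a : R) : expR (s * `|a|) <= expR (s * a) + expR (- (s * a)).
  by case: (ger0P a) => _; rewrite ?lerDl ?expR_ge0// mulrN lerDr expR_ge0.
have := cabs_le_parts (A i); rewrite -/x -/y => cxy.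
(* The modulus is at most twice the larger of [|x|] and [|y|], which is why the rate is half of
   [s]. *)
have [yx|xy] := leP `|y| `|x|.
  apply: (@le_trans _ _ (expR (s * `|x|))).
    by rewrite ler_expR -mulrA ler_wpM2l ?(ltW s0)//; lra.
  by rewrite (le_trans (norm_le x))// lerDl addr_ge0 ?expR_ge0.
apply: (@le_trans _ _ (expR (s * `|y|))).
  by rewrite ler_expR -mulrA ler_wpM2l ?(ltW s0)//; lra.
by rewrite (le_trans (norm_le y))// [leLHS]addrC lerDr addr_ge0 ?expR_ge0.
Qed.

(** A single term of the exponential series gives |A|^k <= (k!/tau^k) e^(tau |A|). *)
Lemma moment_summable k : csummable (fun i => w i * A i ^+ k).
Proof.
have [tau tau0 sm] := exp_moment_summable.
apply: le_csummable (rsummableZ (k`!%:R / tau ^+ k) _ sm) _ => i.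
rewrite cabsM cabsX mulrCA ler_wpM2l ?cabs_ge0//.
have := pow_fact_le_expR _ k (mulr_ge0 (ltW tau0) (cabs_ge0 (A i))).
rewrite ler_pdivrMr ?ltr0n ?fact_gt0// exprMn => h.
rewrite mulrAC ler_pdivlMr ?exprn_gt0// mulrC.
by rewrite (le_trans h)// mulrC.
Qed.

Lemma exp_family_expansion : \forall t \near (0 : C),
  series (fun k : nat => csum (fun i => w i * A i ^+ k) * (t ^+ k / k`!%:R)) @ \oo
    --> csum (fun i => w i * cexp (A i * t)).
Proof.
have [tau tau0 sm] := exp_moment_summable.
(* With this radius the factor e^(5|A t|) of the Taylor bound stays below the summable weight e^(tau
   |A|). *)
suff h : \forall t \near (0 : C), cabs t <= tau / 5.
  near=> t; have st : csummable (fun i => w i * cexp (A i * t)) by near: t.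
  have tt : cabs t <= tau / 5 by near: t.
  set K := psum (fun i => cabs (w i) * expR (tau * cabs (A i))) in sm *.
  have K0 : 0 <= K by apply: psum_ge0 => i; rewrite mulr_ge0 ?cabs_ge0 ?expR_ge0.
  have bound n : cabs (csum (fun i => w i * cexp (A i * t)) -
      series (fun k : nat => csum (fun i => w i * A i ^+ k) * (t ^+ k / k`!%:R)) n)
      <= 4 * K * 2^-1 ^+ n.
    have sk k : csummable (fun i => (t ^+ k / k`!%:R) * (w i * A i ^+ k)).
      exact/csummableZ/moment_summable.
    have [sn En] := csum_bigsum
      (fun k i => (t ^+ k / k`!%:R) * (w i * A i ^+ k)) n sk.
    rewrite /series /=.
    rewrite (eq_bigr (fun k => csum (fun i => (t ^+ k / k`!%:R) * (w i * A i ^+ k))));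
      last by move=> k _; rewrite csumZ 1?mulrC//; exact: moment_summable.
    (* The partial sum is itself a sum over the family, so the error becomes a single sum of Taylor
       remainders. In [4 * K] one factor 2 is from the Taylor bound and one from [cabs_csum_le]. *)
    rewrite -En -mulN1r -csumZ// -csumD//; last exact: csummableZ.
    apply: le_trans.
      apply: (cabs_csum_le _ _ (rsummableZ (2 * 2^-1 ^+ n) _ sm)) => i.
      rewrite [X in cabs X](_ : _ = w i * (cexp (A i * t) - cexp_partial n (A i * t))).
        rewrite cabsM mulrCA ler_wpM2l ?cabs_ge0//.
        rewrite (le_trans (cexp_partial_cvg_bound _ _))// ler_wpM2l//.
        rewrite ler_expR cabsM mulrCA mulrC ler_wpM2r ?cabs_ge0//.
        by move: tt; rewrite ler_pdivlMr// mulrC.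
      rewrite mulN1r mulrBr; congr (_ - _).
      rewrite /cexp_partial mulr_sumr; apply: eq_bigr => k _.
      by rewrite exprMn; ring.
    rewrite psumZ//; first by rewrite -/K; lra.
    by move=> i; rewrite mulr_ge0 ?cabs_ge0 ?expR_ge0.
  apply/cvg_cabsP => e e0.
  have /cvgrPdist_lt /(_ e e0) : (fun n => 4 * K * 2^-1 ^+ n) @ \oo --> (0 : R).
    rewrite -[0 in X in _ --> X](mulr0 (4 * K)); apply: cvgMr.
    by apply: cvg_expr; rewrite ger0_norm ?invr_ge0// invf_lt1// ltr1n.
  apply: filterS => n; rewrite sub0r normrN => lt_e.
  by rewrite (le_lt_trans (bound n))// (le_lt_trans (ler_norm _)).
apply/near0_cabsP; exists (tau / 5) => [|t /ltW//].
by rewrite divr_gt0.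
Unshelve. all: by end_near. Qed.

End ExponentialFamilies.

(** * Uniqueness of power series coefficients *)

Section PowerSeries.
Context {R : realType}.
Notation C := (Cplx R).

(** From some rank on the partial sums have modulus below 1, so a term, being the difference of two
    of them, is at most 2. The finitely many earlier terms are covered by their sum. *)
Lemma power_series_terms_bounded (d : nat -> C) (t : C) :
  series (fun k => d k * t ^+ k) @ \oo --> (0 : C) ->
  exists2 M, 0 <= M & forall k, cabs (d k) * cabs t ^+ k <= M.
Proof.
move=> /cvg_cabsP/(_ 1 ltr01)[N _ hN].
have b0 k : 0 <= cabs (d k) * cabs t ^+ k.
  by rewrite mulr_ge0 ?exprn_ge0 ?cabs_ge0.
exists (2 + \sum_(0 <= k < N) cabs (d k) * cabs t ^+ k) => [|k].
  by rewrite addr_ge0// sumr_ge0.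
have [kN|Nk] := ltnP k N.
  rewrite big_mkord (bigD1 (Ordinal kN))//= addrCA lerDl addr_ge0// sumr_ge0//.
rewrite -[leLHS]addr0 lerD ?sumr_ge0// -cabsX -cabsM.
have /= h1 := hN k Nk; have /= h2 := hN k.+1 (leqW Nk).
move: h1 h2; rewrite !sub0r !cabsN => h1 h2.
have -> : d k * t ^+ k = series (fun k => d k * t ^+ k) k.+1 -
    series (fun k => d k * t ^+ k) k.
  by rewrite /series /= big_nat_recr//= addrAC subrr add0r.
by rewrite (le_trans (cabsD _ _))// cabsN; lra.
Qed.

(** Strong induction on [k]: once the earlier coefficients vanish, the term of index [k] at
    [t = s * x] is opposite to the tail, which is O(x^(k+1)). Dividing by x^k and letting x be small
    forces [d k = 0]. *)
Lemma power_series_eq0 (d : nat -> C) :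
  (\forall t \near (0 : C), series (fun k => d k * t ^+ k) @ \oo --> (0 : C)) ->
  forall k, d k = 0.
Proof.
move=> /near0_cabsP[e e0 de] k.
pose s := e / 2; have s0 : 0 < s by rewrite divr_gt0.
have se : s < e by rewrite /s; lra.
have cs : cabs (rtoc s) = s by rewrite cabs_rtoc gtr0_norm.
have [|M M0 dM] := power_series_terms_bounded d (rtoc s).
  by apply: de; rewrite cs.
rewrite cs in dM.
have [m] := ubnP k; elim: m => // m IH in k *; rewrite ltnS => km.
have {}IH j : (j < k)%N -> d j = 0 by move=> jk; apply: IH; exact: leq_trans km.
have key x : 0 < x -> x <= 2^-1 -> cabs (d k) * s ^+ k <= 2 * M * x.
  move=> x0 x2; have x0' := ltW x0.
  pose t := rtoc (s * x).
  have ct : cabs t = s * x by rewrite cabs_rtoc gtr0_norm// mulr_gt0.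
  (* The tail is compared with a geometric series of ratio 1/2, using [x <= 2^-1]. Keeping its exact
     partial sum 2 - 2 * 2^(-p) lets the induction on [p] close. *)
  have tail p : cabs (series (fun k => d k * t ^+ k) (k.+1 + p)%N - d k * t ^+ k) <=
      M * x ^+ k.+1 * (2 - 2 * 2^-1 ^+ p).
    elim: p => [|p IHp].
      rewrite addn0 /series /= big_nat_recr//= big_nat big1 => [|j /= jk].
        by rewrite add0r subrr cabs0 expr0 mulr1 subrr mulr0.
      by rewrite IH// mul0r.
    rewrite addnS /series /= big_nat_recr//= addrAC.
    rewrite (le_trans (cabsD _ _))//.
    have dle : cabs (d (k.+1 + p)%N * t ^+ (k.+1 + p)) <=
        M * x ^+ k.+1 * 2^-1 ^+ p.
      rewrite cabsM cabsX ct exprMn mulrA -mulrA.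
      rewrite mulrA (le_trans (ler_wpM2r _ (dM _))) ?exprn_ge0//.
      by rewrite exprD mulrA ler_wpM2l ?mulr_ge0 ?exprn_ge0// lerXn2r ?nnegrE ?invr_ge0.
    apply: le_trans (lerD IHp dle) _.
    by rewrite -mulrDr ler_wpM2l ?mulr_ge0 ?exprn_ge0// exprS; lra.
  have lim : cabs (d k * t ^+ k) <= 2 * M * x ^+ k.+1.
    apply/ler_addgt0Pr => eps eps0.
    have /cvg_cabsP/(_ eps eps0)[N _ hN] :
      series (fun k => d k * t ^+ k) @ \oo --> (0 : C).
      by apply: de; rewrite ct (le_lt_trans _ se)// ler_piMr// ?ltW//; lra.
    have /= := hN (k.+1 + N)%N (leq_addl _ _); rewrite sub0r cabsN => hS.
    have tN : M * x ^+ k.+1 * (2 - 2 * 2^-1 ^+ N) <= 2 * M * x ^+ k.+1.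
      have : 0 <= M * x ^+ k.+1 * (2^-1 ^+ N).
        by rewrite !mulr_ge0 ?exprn_ge0 ?invr_ge0.
      by lra.
    rewrite -[X in cabs X](subKr (series (fun k => d k * t ^+ k) (k.+1 + N)%N)).
    rewrite (le_trans (cabsD _ _))// cabsN addrC lerD ?(ltW hS)//.
    exact: le_trans (tail N) tN.
  move: lim; rewrite cabsM cabsX ct exprMn mulrA exprSr mulrA -[leRHS]mulrA.
  by rewrite [x ^+ k * x]mulrC mulrA ler_pM2r ?exprn_gt0.
apply/eqP; rewrite -cabs_eq0 eq_le cabs_ge0 andbT leNgt; apply/negP => dk.
set P := cabs (d k) * s ^+ k in key.
have P0 : 0 < P by rewrite mulr_gt0 ?exprn_gt0.
have Q0 : 0 < P + 2 * M by lra.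
have D0 : 0 < 2 * (P + 2 * M) by rewrite mulr_gt0.
have x0 : 0 < P / (2 * (P + 2 * M)) by rewrite divr_gt0.
have x2 : P / (2 * (P + 2 * M)) <= 2^-1 by rewrite ler_pdivrMr//; lra.
have h := key _ x0 x2; rewrite mulrA ler_pdivlMr// in h.
have : 0 < P * P by exact: mulr_gt0.
have : 0 <= P * M by rewrite mulr_ge0 ?(ltW P0).
by move: h; rewrite !mulrDr; lra.
Qed.

End PowerSeries.

(** * Application to the q-Euler numbers and the q-zeta function *)

Section QEuler.
Context {R : realType}.
Notation C := (Cplx R).
Variables (q lq : C) (r : nat) (x : C) (a : 'I_r -> C) (b : 'I_r -> int).

Definition qEuler_coef (m : {ffun 'I_r -> nat}) : C :=
  (-1) ^+ (\sum_(i < r) m i)%N * q ^ (\sum_(i < r) (b i + 1) * (m i)%:Z).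

(** The difference of two expansions is a power series with sum 0 near the origin and coefficients
    (E_k - E'_k)/k!. *)
Lemma is_qEuler_unique (E E' : nat -> C) :
  is_qEuler q lq x a b E -> is_qEuler q lq x a b E' -> E = E'.
Proof.
move=> hE hE'; apply/funext => k.
suff /(_ k)/eqP : forall k, (E k - E' k) / k`!%:R = 0.
  by rewrite mulf_eq0 invr_eq0 pnatr_eq0 -[k`! == 0%N]negbK -lt0n fact_gt0 orbF
             subr_eq0 => /eqP.
apply: power_series_eq0; apply: filterS2 hE hE' => t h h'.
pose F (E : nat -> C) := series (fun k => E k * (t ^+ k / k`!%:R)).
have hB : (fun n => F E n - F E' n) @ \oo --> (0 : C).
  by rewrite -(subrr (qEuler_gf q lq x a b t)); exact: cvgB h h'.
rewrite (_ : series _ = fun n => F E n - F E' n)//.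
apply/funext => n; rewrite /F /series /= -sumrB.
by apply: eq_bigr => j _; rewrite -mulrBl -mulrA [t ^+ j / _]mulrC.
Qed.

(** The factor q^(m_1+...+m_r) of the power of [- q] supplies the [+ 1] in each [b i + 1]. Adding
    exponents uses [q != 0], since the [b i] may be negative. *)
Lemma qzeta_term_opp_nat n m : q != 0 ->
  qzeta_term q lq x a b (- n%:R) m = qEuler_coef m * qEuler_arg q lq x a m ^+ n.
Proof.
move=> q0; rewrite /qzeta_term cpow_opp_nat /qEuler_coef; congr (_ * _).
have -> : \sum_(i < r) (b i + 1) * (m i)%:Z =
    (\sum_(i < r) m i)%N%:Z + \sum_(i < r) b i * (m i)%:Z.
  rewrite (big_morph Posz PoszD (erefl _)) -big_split /=.
  by apply: eq_bigr => i _; rewrite mulrDl mul1r addrC.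
by rewrite expfzDr// -exprnP (exprNn q) mulrA.
Qed.

End QEuler.

Theorem theorem11 (R : realType) (q lq : Cplx R) (r n : nat) (x : Cplx R)
    (a : 'I_r -> Cplx R) (b : 'I_r -> int)
    (q_lt1 : cabs q < 1) (lqE : cexp lq = q) (r_gt0 : (0 < r)%N)
    (x_gt0 : 0 < cre x) (a_gt0 : forall i, 0 < cre (a i))
    (gf_summable : \forall t \near (0 : Cplx R),
        csummable (qEuler_gf_term q lq x a b t))
    (zeta_summable : csummable (qzeta_term q lq x a b (- n%:R))) :
  qzeta q lq x a b (- n%:R) = qEuler q lq x a b n.
Proof.
have q0 : q != 0 by rewrite -lqE cexp_neq0.
pose E k := qzeta q lq x a b (- k%:R).
suff hE : is_qEuler q lq x a b E.
  (* As an expansion exists, [xget] does not fall back on its default, and uniqueness identifies its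
     choice with [E]. *)
  have hx : is_qEuler q lq x a b (qEuler q lq x a b).
    exact: (xgetPex _ (ex_intro _ E hE)).
  by rewrite -(is_qEuler_unique _ _ _ _ _ _ _ _ hE hx).
apply: filterS (exp_family_expansion _ _ gf_summable) => t ht.
pose F := series (fun k : nat =>
  csum (fun m => qEuler_coef q r b m * qEuler_arg q lq x a m ^+ k) * (t ^+ k / k`!%:R)).
(* The constant [2]_q^r multiplies the limit and is then absorbed into each coefficient. *)
have hF : (fun k => qnum q lq 2%:R ^+ r * F k) @ \oo --> qEuler_gf q lq x a b t.
  exact: cvgMr ht.
rewrite (_ : series _ = fun k => qnum q lq 2%:R ^+ r * F k)//.
apply/funext => k; rewrite /F /series /= mulr_sumr; apply: eq_bigr => j _.
rewrite mulrA /E /qzeta; congr (_ * _ * _); congr csum; apply/funext => m.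
by rewrite qzeta_term_opp_nat.
Qed.
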